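(* Let $Q$ be a smooth manifold with a Riemannian metric $g$, let $\mathcal{D}\subset TQ$ be a smooth distribution of constant rank, and let $\mathcal{P}\colon TQ\to\mathcal{D}$, $\mathcal{Q}\colon TQ\to\mathcal{D}^\perp$ be the complementary orthogonal projectors. Let $L_d\colon Q\times Q\to\mathbb{R}$ be a smooth discrete Lagrangian, and suppose $q_{k-1},q_k,q_{k+1}\in Q$ satisfy the discrete nonholonomic equations $$\mathcal{P}^*_{q_k}\big(D_1L_d(q_k,q_{k+1})\big)+\mathcal{P}^*_{q_k}\big(D_2L_d(q_{k-1},q_k)\big)=0,\qquad \mathcal{Q}^*_{q_k}\big(D_1L_d(q_k,q_{k+1})\big)-\mathcal{Q}^*_{q_k}\big(D_2L_d(q_{k-1},q_k)\big)=0.$$ Put $p^+_{k-1,k}=D_2L_d(q_{k-1},q_k)$ and $p^-_{k,k+1}=-D_1L_d(q_k,q_{k+1})$, both in $T^*_{q_k}Q$. Then the average momentum $\tfrac12\big(p^-_{k,k+1}+p^+_{k-1,k}\big)$ satisfies the nonholonomic constraints, i.e. for every local family of independent one-forms $\mu^a=\mu^a_i\,dq^i$ spanning the annihilator $\mathcal{D}^o$ near $q_k$, $$g^{ij}(q_k)\,\mu^a_i(q_k)\,\frac{(p^-_{k,k+1})_j+(p^+_{k-1,k})_j}{2}=0\qquad\text{for all }a.$$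
   Context: $D_1L_d(q_0,q_1)\in T^*_{q_0}Q$ and $D_2L_d(q_0,q_1)\in T^*_{q_1}Q$ denote the partial differentials of $L_d$. $\mathcal{D}^\perp$ is the $g$-orthogonal complement of $\mathcal{D}$. For $q\in Q$, $\mathcal{P}_q,\mathcal{Q}_q$ are the orthogonal projections of $T_qQ$ onto $\mathcal{D}_q$, $\mathcal{D}_q^\perp$, regarded as endomorphisms of $T_qQ$, and $\mathcal{P}_q^*,\mathcal{Q}_q^*\colon T_q^*Q\to T_q^*Q$ are their dual maps. $(g^{ij})$ is the inverse of the matrix of $g$ in local coordinates $(q^i)$; repeated indices $i,j$ are summed. The annihilator $\mathcal{D}^o\subset T^*Q$ consists of the covectors vanishing on $\mathcal{D}$. The displayed condition on a covector $p\in T^*_{q}Q$ says that the vector $p^\sharp$ with $g(p^\sharp,\cdot)=p$ belongs to $\mathcal{D}_q$. *)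

(* Defs.v *)
From HB Require Import structures.
From mathcomp Require Import all_boot all_order all_algebra.
From mathcomp Require Import sesquilinear.
From mathcomp Require Import boolp classical_sets functions cardinality reals.
From mathcomp Require Import topology normedtype derive.

Set Implicit Arguments.
Unset Strict Implicit.
Unset Printing Implicit Defensive.

Import Order.TTheory GRing.Theory Num.Theory.
Import numFieldNormedType.Exports.

Local Open Scope classical_set_scope.
Local Open Scope ring_scope.

(** * Smooth maps between finite-dimensional normed spaces *)

(* [U] is meant to be open.  For finite-dimensional [V], f is C^(k+1) iff it is
   differentiable and each map x |-> 'd f x v is C^k. *)
Fixpoint Ck_on (R : realType) (V W : normedModType R) (k : nat)
    (U : set V) (f : V -> W) : Prop :=
  if k is k'.+1 then
    (forall x, U x -> differentiable f x) /\
    (forall v : V, Ck_on k' U (fun x => 'd f x v))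
  else forall x, U x -> {for x, continuous f}.

Definition smooth_on (R : realType) (V W : normedModType R)
    (U : set V) (f : V -> W) : Prop :=
  forall k, Ck_on k U f.

(** * Smooth manifolds *)

(* [chart_inv] is a total function; only its values on [chart_im] matter. *)
Record chart (R : realType) (n : nat) (T : topologicalType) := Chart {
  chart_dom : set T ;
  chart_fun :> T -> 'rV[R]_n ;
  chart_inv : 'rV[R]_n -> T ;
  chart_dom_open : open chart_dom ;
  chart_im_open : open (chart_fun @` chart_dom) ;
  chart_funK : forall q, chart_dom q -> chart_inv (chart_fun q) = q ;
  chart_fun_cont : forall q, chart_dom q -> {for q, continuous chart_fun} ;
  chart_inv_cont : forall x, (chart_fun @` chart_dom) x ->
    {for x, continuous chart_inv} }.

Definition chart_im (R : realType) (n : nat) (T : topologicalType)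
    (c : chart R n T) : set 'rV[R]_n := c @` chart_dom c.

Definition chart_compatible (R : realType) (n : nat) (T : topologicalType)
    (c c' : chart R n T) : Prop :=
  smooth_on (c @` (chart_dom c `&` chart_dom c')) (c' \o chart_inv c) /\
  smooth_on (c' @` (chart_dom c `&` chart_dom c')) (c \o chart_inv c').

(* A Hausdorff second countable space with a maximal smooth atlas, together with
   a choice of a chart around each point (used only to represent tangent
   vectors, see [tangent]). *)
Record manifold (R : realType) (n : nat) := Manifold {
  carrier :> topologicalType ;
  carrier_hausdorff : hausdorff_space carrier ;
  carrier_second_countable : @second_countable carrier ;
  atlas : set (chart R n carrier) ;
  atlas_compatible : forall c c', atlas c -> atlas c' -> chart_compatible c c' ;
  atlas_maximal : forall c,
    (forall c', atlas c' -> chart_compatible c c') -> atlas c ;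
  chart_at : carrier -> chart R n carrier ;
  chart_at_atlas : forall q, atlas (chart_at q) ;
  chart_at_dom : forall q, chart_dom (chart_at q) q }.

Arguments chart_at {R n} m q.

Section Tangent.
Variables (R : realType) (n : nat) (M : manifold R n).

(* A tangent vector at q is represented by its components in the chart
   [chart_at M q]; its components in another chart c around q are given by
   [tangent_coord]. *)
Definition tangent (q : M) : vectType R := 'rV[R]_n.

Definition cotangent (q : M) : vectType R := 'Hom(tangent q, R^o).

Definition tangent_coord (c : chart R n M) (q : M) (v : tangent q) : 'rV[R]_n :=
  'd (c \o chart_inv (chart_at M q)) (chart_at M q q) v.

(* The coordinate vector d/dq^i at q of the chart c. *)
Definition coord_vec (c : chart R n M) (q : M) (i : 'I_n) : tangent q :=
  'd (chart_at M q \o chart_inv c) (c q) (delta_mx 0 i : 'rV[R]_n).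

(* The component p_i of p = p_i dq^i in the chart c. *)
Definition cotangent_coord (c : chart R n M) (q : M) (p : cotangent q)
    (i : 'I_n) : R := p (coord_vec c q i).

Definition smooth_vector_field_on (U : set M) (X : forall q, tangent q) : Prop :=
  forall c, atlas c ->
    smooth_on (c @` (chart_dom c `&` U))
      (fun x => tangent_coord c (X (chart_inv c x))).

Definition smooth_one_form_on (U : set M) (mu : forall q, cotangent q) : Prop :=
  forall c, atlas c -> forall i,
    smooth_on (c @` (chart_dom c `&` U))
      (fun x => cotangent_coord c (mu (chart_inv c x)) i : R^o).

Record riemannian_metric := RiemannianMetric {
  metric :> forall q : M, {dot tangent q for idfun} ;
  metric_smooth : forall c, atlas c -> forall i j,
    smooth_on (chart_im c) (fun x => let q := chart_inv c x in
      metric q (coord_vec c q i) (coord_vec c q j) : R^o) }.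

Definition metric_matrix (g : riemannian_metric) (c : chart R n M) (q : M) :
    'M[R]_n :=
  \matrix_(i, j) g q (coord_vec c q i) (coord_vec c q j).

(* A smooth distribution of constant rank r. *)
Record distribution (r : nat) := Distribution {
  dist_at :> forall q : M, {vspace tangent q} ;
  dist_rank : forall q, \dim (dist_at q) = r ;
  dist_smooth : forall q, exists (U : set M)
      (X : 'I_r -> forall q', tangent q'),
    [/\ open U, U q, forall i, smooth_vector_field_on U (X i) &
        forall q', U q' -> dist_at q' = <<[seq X i q' | i : 'I_r]>>%VS] }.

(* D^o_q *)
Definition in_annihilator r (D : distribution r) (q : M) (p : cotangent q) : Prop :=
  forall v, v \in D q -> p v = 0.

Definition dist_orth (g : riemannian_metric) r (D : distribution r) (q : M) :
    {vspace tangent q} := orthov (g q) (D q).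

(* [daddv_pi U V] is the projection onto U along V. *)
Definition proj_dist (g : riemannian_metric) r (D : distribution r) (q : M) :
    'End(tangent q) := daddv_pi (D q) (dist_orth g D q).

Definition proj_orth (g : riemannian_metric) r (D : distribution r) (q : M) :
    'End(tangent q) := daddv_pi (dist_orth g D q) (D q).

Definition dual_map (q : M) (A : 'End(tangent q)) (p : cotangent q) :
    cotangent q := (p \o A)%VF.

Lemma dual_mapE q (A : 'End(tangent q)) (p : cotangent q) v :
  dual_map A p v = p (A v).
Proof. by rewrite /dual_map comp_lfunE. Qed.

Definition smooth_on_product (L : M * M -> R) : Prop :=
  forall c c', atlas c -> atlas c' ->
    smooth_on (chart_im c `*` chart_im c')
      (fun x : 'rV[R]_n * 'rV[R]_n =>
         L (chart_inv c x.1, chart_inv c' x.2) : R^o).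

(* The differential at q of f : M -> R, which acts on components in
   [chart_at M q] as the differential of the local representative of f. *)
Definition mdiff (f : M -> R) (q : M) : cotangent q :=
  linfun ('d (f \o chart_inv (chart_at M q) : 'rV[R]_n -> R^o) (chart_at M q q)).

(* D_1 L (q0, q1) and D_2 L (q0, q1) *)
Definition D1 (L : M * M -> R) (q0 q1 : M) : cotangent q0 :=
  mdiff (fun q => L (q, q1)) q0.

Definition D2 (L : M * M -> R) (q0 q1 : M) : cotangent q1 :=
  mdiff (fun q => L (q0, q)) q1.

End Tangent.

Section ProjTheory.
Variables (R : realType) (n r : nat) (M : manifold R n).
Variables (g : riemannian_metric M) (D : distribution M r) (q : M).

Lemma dist_orthP v :
  reflect (forall w, w \in D q -> g q v w = 0) (v \in dist_orth g D q).
Proof. exact: (mem_orthovP (theta := idfun)). Qed.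

Lemma dist_orth_direct : (D q :&: dist_orth g D q = 0)%VS.
Proof.
apply/eqP; rewrite -subv0; apply/subvP => v; rewrite memv_cap memv0.
case/andP => Dv /dist_orthP/(_ v Dv) gvv0; apply: contraT => v0.
by have := @neq0_dnorm_gt0 _ _ _ (g q) v v0; rewrite gvv0 ltxx.
Qed.

Lemma dist_orth_full : (D q + dist_orth g D q = fullv)%VS.
Proof.
pose b : (\dim (D q)).-tuple (tangent q) := vbasis (D q).
pose f (v : tangent q) : 'rV[R]_(\dim (D q)) := \row_i g q v b`_i.
have flin : linear f.
  by move=> a u v; apply/rowP => i; rewrite !mxE linearPl.
pose F : {linear tangent q -> 'rV[R]_(\dim (D q))} :=
  HB.pack f (GRing.isLinear.Build _ _ _ _ f flin).
have kerF : (lker (linfun F) <= dist_orth g D q)%VS.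
  apply/subvP => v; rewrite memv_ker lfunE => /eqP Fv0.
  apply/dist_orthP => w /coord_vbasis ->; rewrite linear_sumr big1 // => i _.
  rewrite linearZr /=; have := congr1 (fun z : 'rV_ _ => z 0 i) Fv0.
  by rewrite !mxE => ->; rewrite mulr0.
apply/eqP; rewrite eqEdim subvf /= (dimv_disjoint_sum dist_orth_direct).
rewrite -(limg_ker_dim (linfun F) fullv) capfv addnC leq_add ?dimvS //.
by rewrite (leq_trans (dimvS (subvf _))) // dimvf /dim /= mul1n.
Qed.

Lemma proj_dist_orth v : proj_dist g D q v + proj_orth g D q v = v.
Proof.
by apply: daddv_pi_add; rewrite ?dist_orth_direct // dist_orth_full memvf.
Qed.

End ProjTheory.

(* Main.v *)
Require Import Defs.
From mathcomp Require Import all_boot all_order all_algebra.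
From mathcomp Require Import sesquilinear.
From mathcomp Require Import boolp classical_sets functions cardinality reals.
From mathcomp Require Import topology normedtype derive.

Set Implicit Arguments.
Unset Strict Implicit.
Unset Printing Implicit Defensive.

Import Order.TTheory GRing.Theory Num.Theory.
Import numFieldNormedType.Exports.

Local Open Scope classical_set_scope.
Local Open Scope ring_scope.

(** A one-form mu vanishing on D is g(u, -) for a vector u of the orthogonal
    complement of D, and the left-hand side is half the value at u of the sum p
    of the two momenta.  The second equation says that p vanishes on that
    complement.  Raising indices in a chart needs the coordinate vectors to be
    a basis, which is the chain rule for a change of charts. *)

Section CoordinateFrame.
Variables (R : realType) (n : nat) (M : manifold R n).

(** The image of [c] is open, and [chart_inv c] is continuous at [c q], so it sends nearby points
    into the open domain of [c']. *)
Lemma chart_overlap_nbhs (c c' : chart R n M) (q : M) :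
  chart_dom c q -> chart_dom c' q ->
  nbhs (c q) (c @` (chart_dom c `&` chart_dom c')).
Proof.
move=> cq c'q.
have im_cq : (c @` chart_dom c) (c q) by exists q.
have near_im : nbhs (c q) (c @` chart_dom c).
  by apply: open_nbhs_nbhs; split=> //; exact: chart_im_open.
have near_dom' : nbhs (c q) (chart_inv c @^-1` chart_dom c').
  apply: (chart_inv_cont im_cq); apply: open_nbhs_nbhs.
  by split; [exact: chart_dom_open | rewrite chart_funK].
apply: filterS (filterI near_im near_dom') => _ [[q' cq' <-]] /=.
by rewrite chart_funK // => c'q'; exists q'.
Qed.

Lemma transition_differentiable (c c' : chart R n M) (q : M) :
  atlas c -> atlas c' -> chart_dom c q -> chart_dom c' q ->
  differentiable (c' \o chart_inv c) (c q).
Proof.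
move=> ac ac' cq c'q.
have [/(_ 1)[diff _] _] := atlas_compatible ac ac'.
by apply: diff; exists q.
Qed.

(** Chain rule for the two opposite transition maps, whose composite is the identity on the overlap
    of the charts. *)
Lemma transition_diffK (c c' : chart R n M) (q : M) (v : 'rV[R]_n) :
  atlas c -> atlas c' -> chart_dom c q -> chart_dom c' q ->
  'd (c' \o chart_inv c) (c q) ('d (c \o chart_inv c') (c' q) v) = v.
Proof.
move=> ac ac' cq c'q.
have cc'q : (c \o chart_inv c') (c' q) = c q by rewrite /= chart_funK.
have diff' := transition_differentiable ac' ac c'q cq.
have diff_c'q : differentiable (c' \o chart_inv c) ((c \o chart_inv c') (c' q)).
  by rewrite cc'q; exact: transition_differentiable.
have transitionK : {near c' q,
    (c' \o chart_inv c) \o (c \o chart_inv c') =1 id}.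
  apply: filterS (chart_overlap_nbhs c'q cq) => _ [q' [c'q' cq'] <-] /=.
  by rewrite !chart_funK.
have diff_comp_id : 'd ((c' \o chart_inv c) \o (c \o chart_inv c')) (c' q) v = v.
  (* The composite is the identity only near [c' q]; a directional derivative depends on nothing
     more. *)
  rewrite -deriveE; first by rewrite (near_eq_derive v transitionK) derive_id.
  exact: differentiable_comp.
have diff_compE := congr1 (@^~ v) (diff_comp diff' diff_c'q).
have := etrans (esym diff_compE) diff_comp_id.
by rewrite /= chart_funK.
Qed.

(** Jacobian in the row convention: row [i] is [coord_vec c q i]. *)
Definition coord_frame (c : chart R n M) (q : M) : 'M[R]_n :=
  lin1_mx ('d (chart_at M q \o chart_inv c) (c q)).

Lemma mul_coord_frame (c : chart R n M) (q : M) (x : 'rV[R]_n) :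
  x *m coord_frame c q = \sum_i x 0 i *: coord_vec c q i.
Proof.
rewrite mul_rV_lin1 {1}(row_sum_delta x) linear_sum.
by apply: eq_bigr => i _; rewrite linearZ.
Qed.

Lemma coord_frame_unit (c : chart R n M) (q : M) :
  atlas c -> chart_dom c q -> coord_frame c q \in unitmx.
Proof.
move=> ac cq.
(* The Jacobian of the opposite transition is the inverse. *)
pose B : 'M[R]_n := lin1_mx ('d (c \o chart_inv (chart_at M q)) (chart_at M q q)).
have BE : B *m coord_frame c q = 1%:M.
  apply/row_matrixP => i; rewrite !rowE mulmxA !mul_rV_lin1 mulmx1.
  by apply: transition_diffK => //; [exact: chart_at_atlas | exact: chart_at_dom].
by case: (mulmx1_unit BE).
Qed.

Lemma coord_vec_span (c : chart R n M) (q : M) (v : tangent q) :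
  atlas c -> chart_dom c q ->
  exists x : 'rV[R]_n, v = \sum_i x 0 i *: coord_vec c q i.
Proof.
move=> ac cq; exists ((v : 'rV[R]_n) *m invmx (coord_frame c q)).
by rewrite -mul_coord_frame mulmxKV // coord_frame_unit.
Qed.

(** This is a Gram matrix. A row [x] in its left kernel gives a vector [v] orthogonal to every
    coordinate vector, hence to itself; positivity forces [v = 0], and independence of the
    coordinate vectors forces [x = 0]. *)
Lemma metric_matrix_unit (g : riemannian_metric M) (c : chart R n M) (q : M) :
  atlas c -> chart_dom c q -> metric_matrix g c q \in unitmx.
Proof.
move=> ac cq; rewrite -row_free_unit; apply: inj_row_free => x xG0.
pose v : tangent q := \sum_i x 0 i *: coord_vec c q i.
have gv (j : 'I_n) : g q v (coord_vec c q j) = 0.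
  have := congr1 (fun y : 'rV[R]_n => y 0 j) xG0; rewrite !mxE => <-.
  rewrite linear_sumlz; apply: eq_bigr => i _.
  by rewrite linearZl_LR mxE.
have gvv : g q v v = 0.
  by rewrite {2}/v linear_sumr big1 // => j _; rewrite linearZr /= gv mulr0.
have v0 : v = 0.
  apply: contra_eq gvv => v_neq0.
  by rewrite gt_eqF // (@neq0_dnorm_gt0 _ _ _ (g q)).
apply: (row_free_inj (m := 1) (A := coord_frame c q)).
  by rewrite row_free_unit coord_frame_unit.
by rewrite /= mul0mx mul_coord_frame.
Qed.

(** The musical isomorphism: the index of [p] is raised in the chart [c]. *)
Definition sharp (g : riemannian_metric M) (c : chart R n M) (q : M)
    (p : cotangent q) : tangent q :=
  \sum_(j < n) (\sum_(i < n) invmx (metric_matrix g c q) i j *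
    cotangent_coord c p i) *: coord_vec c q j.

Lemma metric_sharp (g : riemannian_metric M) (c : chart R n M) (q : M)
    (p : cotangent q) (v : tangent q) :
  atlas c -> chart_dom c q -> g q (sharp g c p) v = p v.
Proof.
move=> ac cq; have Gunit := metric_matrix_unit g ac cq.
have [x ->] := coord_vec_span v ac cq.
rewrite linear_sumr linear_sum; apply: eq_bigr => k _.
rewrite linearZr linearZ /=; congr (_ * _).
(* On the [k]-th coordinate vector the claim is entry [k] of [P *m invmx G *m G = P], with [G] the
   metric matrix. *)
pose P : 'rV[R]_n := \row_i cotangent_coord c p i.
have := congr1 (fun y : 'rV[R]_n => y 0 k) (mulmxKV Gunit P).
rewrite -/(cotangent_coord c p k) !mxE => <-; rewrite linear_sumlz; apply: eq_bigr => j _.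
rewrite linearZl_LR !mxE; congr (_ * _).
by apply: eq_bigr => i _; rewrite mxE mulrC.
Qed.

Lemma sharp_annihilator (g : riemannian_metric M) r (D : distribution M r)
    (c : chart R n M) (q : M) (p : cotangent q) :
  atlas c -> chart_dom c q -> in_annihilator D p ->
  sharp g c p \in dist_orth g D q.
Proof.
by move=> ac cq Dp; apply/dist_orthP => w Dw; rewrite metric_sharp // Dp.
Qed.

(** Turns the coordinate contraction of the constraint into a pairing of a covector with a
    vector. *)
Lemma apply_sharp (g : riemannian_metric M) (c : chart R n M) (q : M)
    (p p' : cotangent q) :
  p' (sharp g c p) = \sum_(i < n) \sum_(j < n)
    invmx (metric_matrix g c q) i j * cotangent_coord c p i *
    cotangent_coord c p' j.
Proof.
rewrite exchange_big linear_sum; apply: eq_bigr => j _.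
by rewrite linearZ /= -mulr_suml.
Qed.

Lemma proj_orth_id (g : riemannian_metric M) r (D : distribution M r) (q : M)
    (v : tangent q) :
  v \in dist_orth g D q -> proj_orth g D q v = v.
Proof. by apply: daddv_pi_id; rewrite capvC dist_orth_direct. Qed.

End CoordinateFrame.

Theorem mainTheorem3 (R : realType) (n r : nat) (Q : manifold R n)
    (g : riemannian_metric Q) (D : distribution Q r)
    (Ld : Q * Q -> R) (Ld_smooth : smooth_on_product Ld)
    (qprev qk qnext : Q) :
  let P := proj_dist g D qk in
  let P' := proj_orth g D qk in
  dual_map P (D1 Ld qk qnext) + dual_map P (D2 Ld qprev qk) = 0 ->
  dual_map P' (D1 Ld qk qnext) - dual_map P' (D2 Ld qprev qk) = 0 ->
  let pplus : cotangent qk := D2 Ld qprev qk in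
  let pminus : cotangent qk := - D1 Ld qk qnext in
  forall (U : set Q) (m : nat) (mu : 'I_m -> forall q : Q, cotangent q),
    open U -> U qk ->
    (forall a, smooth_one_form_on U (mu a)) ->
    (forall q, U q -> free [seq mu a q | a : 'I_m]) ->
    (forall q, U q -> forall p : cotangent q,
      (p \in <<[seq mu a q | a : 'I_m]>>%VS) <-> in_annihilator D p) ->
  forall c : chart R n Q, atlas c -> chart_dom c qk ->
  forall a : 'I_m,
    \sum_(i < n) \sum_(j < n)
      invmx (metric_matrix g c qk) i j * cotangent_coord c (mu a qk) i *
      ((cotangent_coord c pminus j + cotangent_coord c pplus j) / 2) = 0.
Proof.
move=> P P' _ eqQ pplus pminus U m mu _ Uqk _ _ muD c ac cqk a.
have Dmu : in_annihilator D (mu a qk).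
  by apply/(muD _ Uqk)/memv_span/map_f; rewrite mem_enum.
pose u := sharp g c (mu a qk).
have p_u : (pminus + pplus) u = 0.
  (* Since [u] lies in the orthogonal complement, the projector fixes it, and the second equation at
     [u] reads [D1 - D2 = 0]: up to sign, the vanishing of [pminus + pplus] at [u]. *)
  have := congr1 (fun f : cotangent qk => f u) eqQ.
  rewrite !(add_lfunE, opp_lfunE, zero_lfunE, dual_mapE) proj_orth_id ?sharp_annihilator //.
  by move=> /eqP; rewrite -oppr_eq0 opprB addrC => /eqP.
transitivity ((pminus + pplus) u / 2); last by rewrite p_u mul0r.
rewrite apply_sharp mulr_suml; apply: eq_bigr => i _.
rewrite mulr_suml; apply: eq_bigr => j _.
by rewrite /cotangent_coord add_lfunE mulrA.
Qed.
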